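(* Let $X$ be a quasi-Banach space and let $\mathcal{X}=(X_n)_{n\ge 0}$ be a sequence of nested linear subspaces $X_n\subset X_{n+1}\subset X$ with $\dim(X_n)=n$ whose union is dense in $X$. Write $\mathcal{A}^s_q:=\mathcal{A}^s_q(\mathcal{X},X)$ and let $U(\mathcal{A}^s_q)$ be its unit ball. (i) For any $s>0$ and $0<q\le\infty$ there is $\bar\gamma(s,q,X)\ge 1$ such that for all $\gamma\ge\bar\gamma(s,q,X)$, $$d_n^{c,\gamma}(U(\mathcal{A}^s_q))_X\asymp (n+1)^{-s},\qquad n\ge 0,$$ with constants of equivalence depending only on $s,q$. (ii) Additionally, if $0<s'<s$ and $0<q'\le\infty$, then there is a $\bar\gamma(s,s',q,q',X)\ge 1$ so that for all $\gamma\ge\bar\gamma(s,s',q,q',X)$, $$d_n^{c,\gamma}(U(\mathcal{A}^s_q))_{\mathcal{A}^{s'}_{q'}}\asymp (n+1)^{-(s-s')},\qquad n\ge 0,$$ with constants of equivalence depending on $s,s',q,q'$.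
   Context: For $f\in X$ let $E_n(f)_X:=\inf_{g\in X_n}\|f-g\|_X$, $n\ge 0$, with $X_0=\{0\}$. For $r>0$ and $0<q<\infty$, $\mathcal{A}_q^r=\mathcal{A}_q^r(\mathcal{X},X)$ is the set of $f\in X$ with $$\|f\|_{\mathcal{A}_q^r}:=\Bigl\{\sum_{n\ge 0}[(n+1)^rE_n(f)_X]^q(n+1)^{-1}\Bigr\}^{1/q}<\infty ,$$ and for $q=\infty$, $\|f\|_{\mathcal{A}_\infty^r}:=\sup_{n\ge 0}(n+1)^rE_n(f)_X$. The unit ball is $U(\mathcal{A}_q^r)=\{f:\|f\|_{\mathcal{A}_q^r}\le 1\}$. For a (quasi-)normed space $Z$, a compact set $K\subset Z$ and $\gamma\ge 1$, let $K_\gamma:=\bigcup_{0\le\lambda\le\gamma}\lambda K$. The $\gamma$-constrained Kolmogorov widths are $d_0^{c,\gamma}(K)_Z:=\sup_{f\in K}\|f\|_Z$ and, for $n\ge 1$, $$d_n^{c,\gamma}(K)_Z:=\inf_{\dim V\le n}\ \sup_{f\in K}\ \inf_{v\in V\cap K_\gamma}\|f-v\|_Z,$$ the outer infimum being over linear subspaces $V\subset Z$ with $\dim V\le n$. In (ii), $Z=\mathcal{A}^{s'}_{q'}$ with its own quasi-norm. The notation $a_n\asymp b_n$ means $c\,b_n\le a_n\le C\,b_n$ for all $n\ge0$ with positive constants $c,C$ independent of $n$.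
   Formalization: The lower constant of equivalence may depend, besides s,q (and s',q'), on the quasi-triangle constant of X; a lower constant depending only on s,q is impossible uniformly over all quasi-Banach spaces. The upper constant depends only on s,q (and s',q'). *)

(* Defs.v *)
From HB Require Import structures.
From mathcomp Require Import all_boot all_order all_algebra.
From mathcomp Require Import all_classical all_reals all_analysis.
Set Implicit Arguments.
Unset Strict Implicit.
Unset Printing Implicit Defensive.
Import Order.TTheory GRing.Theory Num.Theory.
Local Open Scope classical_set_scope.
Local Open Scope ring_scope.

(* A quasi-Banach space is a real vector space X with a complete quasi-norm N;
   kappa is the constant of the quasi-triangle inequality. *)
Record quasi_banach (R : realType) (kappa : R) (X : lmodType R) (N : X -> R)
    : Prop := QuasiBanach {
  qnorm_ge0 : forall x, 0 <= N x;
  qnorm_eq0 : forall x, N x = 0 -> x = 0;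
  qnormZ : forall (a : R) x, N (a *: x) = `|a| * N x;
  qnormD : forall x y, N (x + y) <= kappa * (N x + N y);
  qnorm_complete : forall u : nat -> X,
    (forall e : R, 0 < e -> exists m : nat, forall i j : nat,
       (m <= i)%N -> (m <= j)%N -> N (u i - u j) < e) ->
    exists x : X, forall e : R, 0 < e -> exists m : nat, forall i : nat,
       (m <= i)%N -> N (u i - x) < e
}.

(* X need not be finite-dimensional, so the subspaces of the vector library do
   not apply: V is a linear subspace of dimension n iff it is the set of linear
   combinations of n linearly independent vectors (so V = {0} for n = 0). *)
Definition has_dim (R : realType) (X : lmodType R) (V : set X) (n : nat) :=
  exists b : 'I_n -> X,
    (forall c : 'I_n -> R,
       \sum_(i < n) c i *: b i = 0 -> forall i, c i = 0) /\
    V = [set x | exists c : 'I_n -> R, x = \sum_(i < n) c i *: b i].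

Definition dim_le (R : realType) (X : lmodType R) (V : set X) (n : nat) :=
  exists2 m : nat, (m <= n)%N & has_dim V m.

Record approximation_scheme (R : realType) (X : lmodType R) (N : X -> R)
    (XX : nat -> set X) : Prop := ApproximationScheme {
  scheme_nested : forall n, XX n `<=` XX n.+1;
  scheme_dim : forall n, has_dim (XX n) n;
  scheme_dense : forall (f : X) (e : R), 0 < e ->
    exists (n : nat) (g : X), XX n g /\ N (f - g) < e
}.

Definition best_approx (R : realType) (X : lmodType R) (N : X -> R)
    (XX : nat -> set X) (n : nat) (f : X) : R :=
  inf [set N (f - g) | g in XX n].

(* The value +oo means that f is not in A^r_q.  The value at q = -oo is junk. *)
Definition approx_norm (R : realType) (X : lmodType R) (N : X -> R)
    (XX : nat -> set X) (r : R) (q : \bar R) (f : X) : \bar R :=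
  match q with
  | p%:E => poweR (\sum_(0 <= n <oo)
      (((n.+1%:R `^ r * best_approx N XX n f) `^ p) * n.+1%:R^-1)%:E)%E p^-1
  | +oo%E => ereal_sup
      [set (n.+1%:R `^ r * best_approx N XX n f)%:E | n in [set: nat]]
  | -oo%E => 0%E
  end.

Definition approx_ball (R : realType) (X : lmodType R) (N : X -> R)
    (XX : nat -> set X) (r : R) (q : \bar R) : set X :=
  [set f | (approx_norm N XX r q f <= 1)%E].

Definition dilates (R : realType) (X : lmodType R) (K : set X) (gamma : R)
    : set X :=
  [set v | exists lambda : R, 0 <= lambda <= gamma /\
           exists2 f, K f & v = lambda *: f].

(* M is a (quasi-)norm extended by +oo outside Z = {z | M z < +oo}, so that the
   widths in X and in the subspaces A^r_q of X are instances of one notion. *)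
Definition constrained_width (R : realType) (X : lmodType R) (M : X -> \bar R)
    (gamma : R) (K : set X) (n : nat) : \bar R :=
  if n is 0 then ereal_sup [set M f | f in K]
  else ereal_inf
    [set ereal_sup
       [set ereal_inf [set M (f - v) | v in V `&` dilates K gamma] | f in K]
    | V in [set V : set X |
              dim_le V n /\ V `<=` [set v | (M v < +oo)%E]]].

(* Main.v *)
(* Upper bounds: f in the ball has a near-best approximant g in X_n, and since
   E_m(g) <= kappa (2 E_m(f) + eps) for m <= n and E_m(g) = 0 for m >= n, g lies
   in a fixed multiple of the ball; the error f - g is then estimated from the
   decay of E_m(f).
   Lower bounds: by Bernstein's inequality the ball contains the unit ball of
   X_(2n+2), scaled by a power of n.  In a quasi-normed space an n-dimensional
   subspace V cannot approximate the unit ball of a 2n-dimensional W to within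
   a small delta(kappa): the ball of V is covered by (C / delta)^n balls of
   radius delta while that of W needs (c / delta)^(2n).  Instead of volumes, both
   entropy bounds come from a self-similarity argument: a packing or a cover is
   iterated K times, so that as K grows only the dimension matters. *)
Require Import Defs.
From HB Require Import structures.
From mathcomp Require Import all_boot all_order all_algebra.
From mathcomp Require Import all_classical all_reals all_analysis.
From mathcomp Require Import ring lra.
Set Implicit Arguments.
Unset Strict Implicit.
Unset Printing Implicit Defensive.
Import Order.TTheory GRing.Theory Num.Theory.
Import numFieldNormedType.Exports.
Local Open Scope classical_set_scope.
Local Open Scope ring_scope.


(** * Packing and covering in quasi-normed spaces *)

(* [P x r] stands for [M x <= r], where [M] is a quasi-norm with values in
   [0, +oo] and with constant [kappa]. *)
Record gauge (R : realType) (kappa : R) (X : lmodType R) (P : X -> R -> Prop)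
    : Prop := Gauge {
  gauge_ge0 : forall x r, P x r -> 0 <= r;
  gauge_le : forall x r r', P x r -> r <= r' -> P x r';
  gaugeZ : forall (a : R) x r, P x r -> P (a *: x) (`|a| * r);
  gaugeD : forall x y r t, P x r -> P y t -> P (x + y) (kappa * (r + t));
  gauge_eq0 : forall x, (forall e, 0 < e -> P x e) -> x = 0
}.

Definition lincomb (R : realType) (X : lmodType R) (k : nat) (b : 'I_k -> X)
  (c : 'I_k -> R) : X := \sum_(i < k) c i *: b i.

Definition indep (R : realType) (X : lmodType R) (k : nat) (b : 'I_k -> X) :=
  forall c : 'I_k -> R, lincomb b c = 0 -> forall i, c i = 0.

Lemma lincombB (R : realType) (X : lmodType R) (k : nat)
    (b : 'I_k -> X) c d :
  lincomb b (fun i => c i - d i) = lincomb b c - lincomb b d.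
Proof. by rewrite /lincomb -sumrB; apply: eq_bigr => i _; rewrite scalerBl. Qed.

Lemma lincombZ (R : realType) (X : lmodType R) (k : nat)
    (b : 'I_k -> X) a c :
  lincomb b (fun i => a * c i) = a *: lincomb b c.
Proof.
by rewrite /lincomb scaler_sumr; apply: eq_bigr => i _; rewrite scalerA.
Qed.

Lemma lincombD (R : realType) (X : lmodType R) (k : nat)
    (b : 'I_k -> X) c d :
  lincomb b (fun i => c i + d i) = lincomb b c + lincomb b d.
Proof.
by rewrite /lincomb -big_split; apply: eq_bigr => i _; rewrite scalerDl.
Qed.

Lemma bernoulli (R : realType) (a : R) (K : nat) :
  0 <= a -> 1 + K%:R * (a - 1) <= a ^+ K.
Proof.
move=> a0; elim: K => [|K IH]; first by rewrite mul0r addr0 expr0.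
rewrite exprS -natr1.
have : a * (1 + K%:R * (a - 1)) <= a * a ^+ K by rewrite ler_wpM2l.
have : 0 <= K%:R * (a - 1) ^+ 2 by rewrite mulr_ge0 // sqr_ge0.
lra.
Qed.

(** By Bernoulli's inequality the powers of a number above 1 are unbounded. In the counting
    arguments below this discards every constant that does not grow with [K]. *)
Lemma expr_bounded_le1 (R : realType) (a D : R) :
  0 <= a -> (forall K : nat, a ^+ K <= D) -> a <= 1.
Proof.
move=> a0 aD; rewrite leNgt; apply/negP => a1.
have := bernoulli (Num.trunc (D / (a - 1))).+1 a0.
have := aD (Num.trunc (D / (a - 1))).+1.
have := truncnS_gt (D / (a - 1)); rewrite ltr_pdivrMr ?subr_gt0 //.
lra.
Qed.

Section Gauge.
Context (R : realType) (kappa : R) (X : lmodType R) (P : X -> R -> Prop).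
Hypotheses (k1 : 1 <= kappa) (gP : gauge kappa P).

Let k0 : 0 < kappa. Proof. exact: lt_le_trans k1. Qed.

Lemma gauge_scale (a : R) x r t : P x r -> `|a| * r <= t -> P (a *: x) t.
Proof. by move=> Px; apply: (gauge_le gP) (gaugeZ gP _ Px). Qed.

Lemma gauge_unscale (a : R) x r : 0 < a -> P (a *: x) (a * r) -> P x r.
Proof.
move=> a0 Pax.
have -> : x = a^-1 *: (a *: x) by rewrite scalerA mulVf ?gt_eqF // scale1r.
apply: gauge_scale Pax _; rewrite ger0_norm ?invr_ge0; last exact: ltW.
by rewrite mulrA mulVf ?gt_eqF // mul1r.
Qed.

Lemma gauge_add x y r t u : P x r -> P y t -> kappa * (r + t) <= u ->
  P (x + y) u.
Proof. by move=> Px Py; apply: (gauge_le gP) (gaugeD gP Px Py). Qed.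

Lemma gaugeN x r : P x r -> P (- x) r.
Proof.
by move=> Px; rewrite -scaleN1r; apply: gauge_scale Px _; rewrite normrN1 mul1r.
Qed.

Lemma gauge_sub x y r t u : P x r -> P y t -> kappa * (r + t) <= u ->
  P (x - y) u.
Proof. by move=> Px /gaugeN; apply: gauge_add. Qed.

Lemma gauge0 x r : P x r -> P 0 0.
Proof. by move=> /(gaugeZ gP 0); rewrite scale0r normr0 mul0r. Qed.

(** Upper half of the comparison of the gauge with the sup norm of coordinates; [gauge_coord_bound]
    is the lower half. *)
Lemma gauge_lincomb k (b : 'I_k -> X) :
  P 0 0 -> (forall i, exists r, P (b i) r) ->
  exists2 B : R, 0 < B & forall (c : 'I_k -> R) (h : R),
    0 <= h -> (forall i, `|c i| <= h) -> P (lincomb b c) (B * h).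
Proof.
move=> P00 Pb; rewrite /lincomb; elim: (index_enum _) => [|i s [B B0 IH]].
  exists 1 => // c h h0 _; rewrite big_nil; apply: (gauge_le gP) P00 _ => //.
  by rewrite mul1r.
have [r Pr] := Pb i; have r0 := gauge_ge0 gP Pr.
exists (kappa * (r + B)); first by rewrite mulr_gt0 // ltr_wpDl.
move=> c h h0 ch; rewrite big_cons.
apply: (gauge_add (r := h * r) (t := B * h)); last 1 first.
- by rewrite -mulrA mulrDl [r * h]mulrC.
- by apply: gauge_scale Pr _; rewrite ler_wpM2r.
- exact: IH.
Qed.

(* Compactness of the faces [c i0 = 1] of the unit cube. *)
Lemma gauge_coord_bound k (b : 'I_k -> X) : P 0 0 ->
  (forall i, exists r, P (b i) r) -> indep b ->
  exists2 H : R, 0 < H & forall c r, P (lincomb b c) r ->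
    forall i, `|c i| <= H * r.
Proof.
move=> P00 Pb ib; have [B B0 hB] := gauge_lincomb P00 Pb.
pose F (i0 i : 'I_k) : set R :=
  if i == i0 then `[1, 1]%classic else `[(-1), 1]%classic.
pose A i0 := [set v : 'rV[R]_k | forall i : 'I_k, F i0 i (v ord0 i)].
have cA i0 : compact (A i0).
  apply: rV_compact => i.
  by rewrite /F; case: ifP => _; exact: segment_compact.
(* The gauge need not be continuous, so compactness is used in its near-covering form: around each
   point of a face the gauge bound fails for all nearby points and all small [e], hence one [e]
   serves all the faces. *)
have near_e : \forall e \near (0 : R)^'+, forall i0, A i0 `<=`
    [set v | ~ P (lincomb b (v ord0)) e].
  apply: filter_forall => i0.
  have /compact_near_coveringP cov := cA i0.
  apply: (cov _ _ (fun e v => ~ P (lincomb b (v ord0)) e)) => v Av.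
  have nz : lincomb b (v ord0) <> 0.
    move=> /ib /(_ i0) v0; have := Av i0; rewrite /F eqxx /= v0 in_itv /=.
    by rewrite ler10.
  have [e0 [e00 Pe0]] : exists e0, 0 < e0 /\ ~ P (lincomb b (v ord0)) e0.
    apply: contrapT => no; apply: nz; apply: (gauge_eq0 gP) => e e0.
    by apply: contrapT => nP; apply: no; exists e.
  (* A coordinate change below [h] costs at most [e0 / (2 * kappa)], and [e] stays below the same
     bound; together they would give the gauge bound [e0] at [v]. *)
  pose h := e0 / (2 * kappa * (B + 1)).
  have h0 : 0 < h by rewrite divr_gt0 // !mulr_gt0 // addr_gt0.
  exists ([set w : 'rV[R]_k | forall i, `|v ord0 i - w ord0 i| < h],
    [set e | e < e0 / (2 * kappa)]).
    split => /=.
      apply: filterS (nbhsx_ballx v h h0) => w [_ vw] i.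
      by have := vw ord0 i; rewrite -ball_normE.
    by apply: nbhs_right_lt; rewrite divr_gt0 // mulr_gt0.
  case=> w e /= [vw elt] Pe; apply: Pe0.
  have Pvw : P (lincomb b (fun i => v ord0 i - w ord0 i)) (B * h).
    apply: hB => [|i]; first exact: ltW.
    exact: ltW.
  have -> : lincomb b (v ord0) =
      lincomb b (fun i => v ord0 i - w ord0 i) + lincomb b (w ord0).
    by rewrite lincombB subrK.
  apply: (gauge_add Pvw Pe); rewrite -ler_pdivlMl //.
  have : B * h <= e0 / (2 * kappa).
    rewrite /h -[leRHS]mul1r; have -> : B * (e0 / (2 * kappa * (B + 1))) =
      B / (B + 1) * (e0 / (2 * kappa)).
      by field; rewrite !gt_eqF // addr_gt0.
    rewrite ler_wpM2r //; first by rewrite divr_ge0 ?mulr_ge0 // ltW.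
    by rewrite ler_pdivrMr ?addr_gt0 // mul1r lerDl.
  have -> : kappa^-1 * e0 = e0 / (2 * kappa) + e0 / (2 * kappa).
    by field; rewrite gt_eqF.
  by move: elt; lra.
have [e [he e0]] : exists e, (forall i0, A i0 `<=`
    [set v | ~ P (lincomb b (v ord0)) e]) /\ 0 < e.
  near (0 : R)^'+ => e; exists e; split; last by near: e; exact: nbhs_right_gt.
  by near: e.
exists e^-1; first by rewrite invr_gt0.
move=> c r Pr i; have r0 := gauge_ge0 gP Pr.
(* Division by the coordinate of largest modulus puts the vector on the face [A m], where the gauge
   bound [e] fails. *)
pose m := [arg max_(j > i) `|c j|]%O.
have cm j : `|c j| <= `|c m|.
  by rewrite /m; case: arg_maxP => // m' _ /(_ j isT).
apply: le_trans (cm i) _.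
have [->|cm0] := eqVneq (c m) 0; first by
  rewrite normr0 mulr_ge0 // invr_ge0 ltW.
pose v : 'rV[R]_k := \row_j ((c m)^-1 * c j).
have Av : A m v.
  move=> j; rewrite /F mxE; case: eqVneq => [->|_].
    by rewrite mulVf // /= in_itv /= lexx.
  by rewrite /= in_itv /= -ler_norml normrM normfV ler_pdivrMl ?normr_gt0 //
    mulr1.
have := he m v Av; rewrite ler_pdivlMl // => nP.
rewrite mulrC leNgt; apply/negP => rlt; apply: nP.
have -> : lincomb b (v ord0) = (c m)^-1 *: lincomb b c.
  by rewrite -lincombZ; apply: eq_bigr => j _; rewrite mxE.
apply: gauge_scale Pr _; rewrite normfV ler_pdivrMl ?normr_gt0 //; exact: ltW.
Unshelve. all: by end_near.
Qed.
End Gauge.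

Section Words.
Context (R : realType) (X : lmodType R) (M : nat) (x : 'I_M -> X) (theta : R).

(** Horner form of a finite geometric sum: prepending a letter shrinks the old sum by [theta], so
    inductions on words peel off the first letter. *)
Fixpoint word_sum (w : seq 'I_M) : X :=
  if w is i :: w' then x i + theta *: word_sum w' else 0.

(** The bound is uniform in the length of the word: as [theta <= 1/2], a bound [2 * A] on the tail
    is reproduced by [A + theta * (2 * A) <= 2 * A]. *)
Lemma word_sum_lincomb k (b : 'I_k -> X) :
  0 <= theta <= 2^-1 -> (forall i, exists c, x i = lincomb b c) ->
  exists2 A : R, 0 <= A & forall w : seq 'I_M,
    exists2 c, word_sum w = lincomb b c & forall l, `|c l| <= A.
Proof.
move=> /andP[t0 t2] /choice[c xc].
pose A := \sum_(i < M) \sum_(l < k) `|c i l|.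
have cA i l : `|c i l| <= A.
  rewrite /A (bigD1 i) //= (bigD1 l) //= -addrA lerDl addr_ge0 //.
    exact: sumr_ge0.
  by apply: sumr_ge0 => j _; exact: sumr_ge0.
have A0 : 0 <= A by apply: sumr_ge0 => i _; exact: sumr_ge0.
exists (2 * A); first by rewrite mulr_ge0.
elim=> [|i w [d wd dA]] /=.
  exists (fun=> 0); last by move=> l; rewrite normr0 mulr_ge0.
  by rewrite /lincomb big1 // => l _; rewrite scale0r.
exists (fun l => c i l + theta * d l).
  by rewrite lincombD lincombZ -xc -wd.
move=> l; apply: le_trans (ler_normD _ _) _; rewrite normrM (ger0_norm t0).
have : theta * `|d l| <= 2^-1 * (2 * A) by rewrite ler_pM.
by move: (cA i l); lra.
Qed.
End Words.

(* If finitely many points [x i] of a [k]-dimensional space are [rho]-separated,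
   the [M ^ K] words [sum_(j < K) theta ^ j x_(w_j)] stay bounded and are
   [theta ^ K]-separated up to constants; letting [K] grow removes all the
   constants that depend on the space. *)
Lemma packing_bound (R : realType) (kappa : R) (X : lmodType R)
    (P : X -> R -> Prop) (k M : nat) (b : 'I_k -> X) (x : 'I_M -> X)
    (tau rho : R) :
  1 <= kappa -> gauge kappa P -> (forall i, exists r, P (b i) r) ->
  (forall i, exists c, x i = lincomb b c) ->
  0 < rho <= tau -> (forall i, P (x i) tau) ->
  (forall i j, i != j -> ~ P (x i - x j) rho) ->
  M%:R <= (8 * kappa ^+ 3 * tau / rho) ^+ k.
Proof.
move=> k1 gP Pb xb /andP[rho0 rhotau] Px sep.
have k0 : 0 < kappa by exact: lt_le_trans k1.
have tau0 : 0 < tau by exact: lt_le_trans rhotau.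
have [M0|M0] := posnP M.
  by rewrite M0 exprn_ge0 // divr_ge0 ?mulr_ge0 ?exprn_ge0 // ltW.
have P00 : P 0 0 := gauge0 gP (Px (Ordinal M0)).
(* With this [theta] the difference of two tails contributes at most [rho / (2 * kappa)], which is
   also the value of [sigma]; by the quasi-triangle inequality the two add up to [rho]. *)
pose theta := rho / (8 * kappa ^+ 3 * tau).
have den0 : 0 < 8 * kappa ^+ 3 * tau by rewrite !mulr_gt0 ?exprn_gt0.
have th0 : 0 < theta by rewrite divr_gt0.
have kk3 : kappa <= kappa ^+ 3.
  by rewrite -[leLHS]expr1 ler_weXn2l.
have thk : 2 * kappa * theta <= 4^-1.
  rewrite /theta mulrA ler_pdivrMr //.
  have : kappa * rho <= kappa ^+ 3 * tau by rewrite ler_pM // ltW.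
  by lra.
have th2 : theta <= 2^-1.
  have : theta <= kappa * theta by rewrite ler_peMl // ltW.
  by move: thk; lra.
have [A A0 hA] := word_sum_lincomb (b := b) (x := x) (theta := theta)
  (introT andP (conj (ltW th0) th2)) xb.
have [B B0 hB] := gauge_lincomb k1 gP P00 Pb.
pose S := word_sum x theta.
(* A radius stable under prepending a letter: [kappa * (tau + theta * T) <= T], because
   [2 * kappa * theta <= 1/4]. *)
pose T := 2 * kappa * tau.
have ST w : P (S w) T.
  elim: w => [|i w IH] /=.
    by apply: (gauge_le gP) P00 _; rewrite /T !mulr_ge0 // ltW.
  have PtS : P (theta *: S w) (theta * T).
    by apply: (gauge_scale gP) IH _; rewrite ger0_norm // ltW.
  apply: (gauge_add gP) (Px i) PtS _.
  rewrite /T; have : kappa * (theta * (2 * kappa * tau)) <= kappa * tau.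
    have : 2 * kappa * theta * tau <= 4^-1 * tau by rewrite ler_pM2r.
    by rewrite ler_pM2l //; move: tau0; lra.
  by lra.
pose sigma := rho / (2 * kappa).
have sig0 : 0 < sigma by rewrite divr_gt0 // mulr_gt0.
(* Equal first letters cancel at the price of one factor [theta]; at the first differing letter the
   tails are too small to undo the [rho]-separation. *)
have sepw (w w' : seq 'I_M) : size w = size w' -> w <> w' ->
    ~ P (S w - S w') (theta ^+ size w * sigma).
  elim: w w' => [|i w IH] [|i' w'] //= [sz] neq Pd.
  have dE : S (i :: w) - S (i' :: w') = x i - x i' + theta *: (S w - S w').
    by rewrite /S /= scalerBr opprD addrACA.
  have [ii|nii] := eqVneq i i'.
    subst i'; apply: (IH w' sz) => [ww|]; first by apply: neq; rewrite ww.
    apply: (gauge_unscale gP th0); move: Pd; rewrite -/(S _) -/(S (i :: w)).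
    by rewrite -/(S (i :: w')) dE subrr add0r exprS mulrA.
  apply: (sep _ _ nii).
  have -> : x i - x i' = (S (i :: w) - S (i' :: w')) - theta *: (S w - S w').
    by rewrite dE addrK.
  have P1 : P (S (i :: w) - S (i' :: w')) sigma.
    apply: (gauge_le gP) Pd _; rewrite ler_piMl ?(ltW sig0) //.
    by apply: exprn_ile1; [exact: ltW | apply: le_trans th2 _; lra].
  have P2 : P (theta *: (S w - S w')) (theta * (kappa * (T + T))).
    apply: (gauge_scale gP) (gauge_sub gP (ST w) (ST w') (lexx _)) _.
    by rewrite ger0_norm // ltW.
  apply: (gauge_sub gP) P1 P2 _.
  rewrite /sigma /T /theta le_eqVlt; apply/orP; left; apply/eqP.
  by field; rewrite !gt_eqF.
pose D := 4 * A * B / sigma + 1.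
(* Pigeonhole: coordinates in [[-A, A]] fall into [L] cells of side [h], where [B * h] is the
   separation of the words, so no two words share all their cells. Thus [M ^ K <= L ^ k] with
   [L * theta ^ K <= D], and [D] does not depend on [K]. *)
have count K : (M%:R * theta ^+ k) ^+ K <= D ^+ k.
  pose h := theta ^+ K * sigma / B.
  have h0 : 0 < h by rewrite divr_gt0 // mulr_gt0 // exprn_gt0.
  have /choice[c cE] (w : K.-tuple 'I_M) : exists c : 'I_k -> R,
      S w = lincomb b c /\ forall l, `|c l| <= A.
    by have [c ? ?] := hA w; exists c.
  pose L := (Num.trunc (2 * A / h)).+1.
  have cellL w l : (Num.trunc ((c w l + A) / h) < L)%N.
    rewrite ltnS le_truncn // ler_pM2r ?invr_gt0 //.
    by have [_ /(_ l)] := cE w; rewrite ler_norml => /andP[_]; lra.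
  pose f (w : K.-tuple 'I_M) : {ffun 'I_k -> 'I_L} :=
    [ffun l => Ordinal (cellL w l)].
  have finj : injective f.
    move=> w w' /ffunP ff; apply: val_inj; apply: contrapT => neq.
    apply: (sepw w w' _ neq); first by rewrite !size_tuple.
    rewrite size_tuple (cE w).1 (cE w').1 -lincombB.
    apply: (gauge_le gP) (hB _ h (ltW h0) _) _; last first.
      by rewrite /h mulrC divfK // gt_eqF.
    move=> l; have /(congr1 val) := ff l; rewrite !ffunE /= => tt.
    have pos v : 0 <= (c v l + A) / h.
      rewrite divr_ge0 ?(ltW h0) //.
      by have [_ /(_ l)] := cE v; rewrite ler_norml => /andP[]; lra.
    have cell v : (Num.trunc ((c v l + A) / h))%:R * h <= c v l + A <
        (Num.trunc ((c v l + A) / h))%:R * h + h.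
      have := truncn_itv (pos v).
      by rewrite -natr1 ler_pdivlMr // ltr_pdivrMr // [(_ + 1) * h]mulrDl mul1r.
    have := cell w; have := cell w'; rewrite -tt => /andP[? ?] /andP[? ?].
    by rewrite ler_norml; lra.
  have := leq_card f finj; rewrite card_tuple card_ffun !card_ord.
  rewrite -(ler_nat R) !natrX => card.
  have tK1 : theta ^+ K <= 1.
    by apply: exprn_ile1; [exact: ltW | apply: le_trans th2 _; lra].
  have LD : L%:R * theta ^+ K <= D.
    rewrite /L -natr1 mulrDl mul1r /D lerD //.
    have : (Num.trunc (2 * A / h))%:R <= 2 * A / h.
      rewrite truncn_le divr_ge0 ?(ltW h0) //; exact: mulr_ge0.
    move=> /(ler_wpM2r (ltW (exprn_gt0 K th0))) /le_trans; apply.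
    have -> : 2 * A / h * theta ^+ K = 2 * A * B / sigma.
      by rewrite /h; field; rewrite !gt_eqF // exprn_gt0.
    rewrite ler_pM2r ?invr_gt0 // ler_pM2r //; lra.
  rewrite exprMn -exprM mulnC exprM.
  apply: le_trans (_ : L%:R ^+ k * (theta ^+ K) ^+ k <= _).
    by rewrite ler_wpM2r // exprn_ge0 // exprn_ge0 // ltW.
  rewrite -exprMn lerXn2r // nnegrE.
    by rewrite mulr_ge0 // exprn_ge0 // ltW.
  apply: addr_ge0 => //; apply: divr_ge0 (ltW sig0).
  by rewrite mulr_ge0 ?mulr_ge0 // ltW.
have a0 : 0 <= M%:R * theta ^+ k by rewrite mulr_ge0 // exprn_ge0 // ltW.
have := expr_bounded_le1 a0 count.
rewrite -ler_pdivlMr ?exprn_gt0 // mul1r -exprVn.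
by rewrite /theta invf_div.
Qed.

(* Dual to [packing_bound]: a cover of the unit ball by [M] balls of radius
   [rho] iterates to a cover by [M ^ K] balls of radius [rho ^ K], which must
   separate the points of a grid of mesh of order [rho ^ K]. *)
Lemma covering_bound (R : realType) (kappa : R) (X : lmodType R)
    (P : X -> R -> Prop) (m M : nat) (w : 'I_m -> X) (y : 'I_M -> X) (rho : R) :
  1 <= kappa -> gauge kappa P -> (forall i, exists r, P (w i) r) -> indep w ->
  0 < rho -> (forall i, exists c, y i = lincomb w c) ->
  (forall c, P (lincomb w c) 1 -> exists i, P (lincomb w c - y i) rho) ->
  P 0 0 -> rho ^- m <= M%:R.
Proof.
move=> k1 gP Pw iw rho0 yw cov P00.
have k0 : 0 < kappa by exact: lt_le_trans k1.
have [B B0 hB] := gauge_lincomb k1 gP P00 Pw.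
have [H H0 hH] := gauge_coord_bound k1 gP P00 Pw iw.
(* After subtraction of a centre, the remainder divided by [rho] is again in the unit ball, and in
   the span of [w] because the centres are; the cover applies to it anew. *)
have iter_cover K c : P (lincomb w c) 1 -> exists u : K.-tuple 'I_M,
    P (lincomb w c - word_sum y rho u) (rho ^+ K).
  elim: K c => [|K IH] c Pc.
    by exists [tuple]; rewrite /= subr0.
  have [i Pi] := cov c Pc; have [d yd] := yw i.
  pose e l := rho^-1 * (c l - d l).
  have eE : lincomb w c - y i = rho *: lincomb w e.
    rewrite -lincombZ yd -lincombB; apply: eq_bigr => l _.
    by rewrite mulVKf ?gt_eqF.
  have Pe : P (lincomb w e) 1.
    by apply: (gauge_unscale gP rho0); rewrite -eE mulr1.
  have [u Pu] := IH e Pe.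
  exists [tuple of i :: u] => /=.
  rewrite opprD addrA eE -scalerBr exprS.
  by apply: (gauge_scale gP) Pu _; rewrite ger0_norm // ltW.
have M0 : (0 < M)%N.
  have [|i _] := cov (fun=> 0); last exact: leq_ltn_trans (ltn_ord i).
  rewrite /lincomb big1 => [|l _]; last by rewrite scale0r.
  exact: (gauge_le gP) P00 _.
pose E := (3 * B * kappa * H)^-1.
have E0 : 0 < E by rewrite invr_gt0 !mulr_gt0.
have count K : (rho ^- m / M%:R) ^+ K <= E ^- m.
  (* Grid points sharing a word have coordinates that differ by at most [2 * kappa * H * rho ^ K],
     less than the mesh [h]. Coordinates up to [B^-1] keep the grid in the unit ball. *)
  pose h := 3 * kappa * H * rho ^+ K.
  have h0 : 0 < h by rewrite !mulr_gt0 // exprn_gt0.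
  pose L := (Num.trunc (B^-1 / h)).+1.
  pose c (g : {ffun 'I_m -> 'I_L}) (l : 'I_m) : R := (g l)%:R * h.
  have Pc g : P (lincomb w (c g)) 1.
    apply: (gauge_le gP) (hB _ B^-1 _ _) _; last by rewrite divff ?gt_eqF.
      by rewrite invr_ge0 ltW.
    move=> l; rewrite /c ger0_norm; last exact: mulr_ge0 (ltW h0).
    rewrite -ler_pdivlMr //.
    apply: le_trans (_ : (Num.trunc (B^-1 / h))%:R <= _).
      by rewrite ler_nat -ltnS.
    by rewrite truncn_le; apply: divr_ge0 (ltW h0); rewrite invr_ge0 ltW.
  have /choice[u uE] (g : {ffun 'I_m -> 'I_L}) := iter_cover K _ (Pc g).
  have uinj : injective u.
    move=> g g' ug; apply/ffunP => l; apply/val_inj/eqP; apply: contraT => neq.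
    have Pgg : P (lincomb w (fun l => c g l - c g' l))
        (kappa * (rho ^+ K + rho ^+ K)).
      rewrite lincombB -(subrKA (word_sum y rho (u g))).
      rewrite -[_ - lincomb _ (c g')]opprB.
      by apply: (gauge_sub gP) (uE g) _ (lexx _); rewrite ug; exact: uE.
    have := hH _ _ Pgg l; rewrite /c -mulrBl normrM (gtr0_norm h0).
    have n1 : 1 <= `|(g l)%:R - (g' l)%:R| :> R.
      move: neq; rewrite neq_ltn => /orP[] lt.
        rewrite distrC -natrB ?(ltnW lt) // ger0_norm // ler1n subn_gt0 //.
      by rewrite -natrB ?(ltnW lt) // ger0_norm // ler1n subn_gt0.
    have : 1 * h <= `|(g l)%:R - (g' l)%:R| * h by rewrite ler_wpM2r // ltW.
    have : 0 < kappa * H * rho ^+ K by rewrite !mulr_gt0 // exprn_gt0.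
    by rewrite /h; lra.
  have := leq_card u uinj; rewrite card_tuple card_ffun !card_ord.
  rewrite -(ler_nat R) !natrX => card.
  have LE : E * rho ^- K <= L%:R.
    apply: ltW; apply: le_lt_trans (truncnS_gt _).
    rewrite le_eqVlt; apply/orP; left; apply/eqP.
    by rewrite /E /h; field; rewrite !gt_eqF // exprn_gt0.
  have -> : (rho ^- m / M%:R) ^+ K = (rho ^- K) ^+ m / M%:R ^+ K.
    by rewrite exprMn !exprVn -!exprM mulnC.
  rewrite ler_pdivrMr ?exprn_gt0 ?ltr0n // -(ler_pM2l (exprn_gt0 m E0)).
  rewrite mulrA divff ?mul1r; last by rewrite gt_eqF // exprn_gt0.
  apply: le_trans card.
  rewrite -exprMn lerXn2r // nnegrE; last exact: ler0n.
  apply: mulr_ge0 (ltW E0) _; rewrite invr_ge0 exprn_ge0 //; exact: ltW.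
have a0 : 0 <= rho ^- m / M%:R by rewrite divr_ge0 // invr_ge0 exprn_ge0 // ltW.
by have := expr_bounded_le1 a0 count; rewrite ler_pdivrMr ?ltr0n // mul1r.
Qed.

(** By contradiction: a maximal [rho]-separated family in the part of [V] of gauge at most
    [2 * kappa], once moved into [W], covers the unit ball of [W] with radius [4 * kappa ^ 2 * rho].
    Packing and covering bounds then give [(4 * kappa ^ 2 * rho) ^ (-2n) <= (16 * kappa ^ 4 / rho) ^
    n], that is [1 <= (2 * kappa) ^ 8 * rho], which fails for [rho = (2 * kappa) ^ -9]. *)
Lemma gauge_width_lb (R : realType) (kappa : R) (X : lmodType R)
    (P : X -> R -> Prop) (n : nat) (V W : set X) :
  1 <= kappa -> gauge kappa P -> (0 < n)%N -> dim_le V n -> has_dim W n.*2 ->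
  (forall x, V x \/ W x -> exists r, P x r) ->
  exists x, [/\ W x, P x 1 & forall v, V v -> ~ P (x - v) ((2 * kappa) ^- 9)].
Proof.
move=> k1 gP n0 [k kn [b [ib Vb]]] [w [iw Ww]] fin.
have k0 : 0 < kappa by exact: lt_le_trans k1.
set rho := _^-1; apply: contrapT => no.
have rho0 : 0 < rho by rewrite invr_gt0 exprn_gt0 // mulr_gt0.
have rho1 : rho <= 1.
  rewrite invf_le1; last by rewrite exprn_gt0 // mulr_gt0.
  by rewrite exprn_ege1 //; move: k1; lra.
have genE j (c : 'I_j -> X) i : c i = lincomb c (fun l => (l == i)%:R).
  rewrite /lincomb (bigD1 i) //= eqxx scale1r big1 ?addr0 // => l /negPf ->.
  by rewrite scale0r.
have Vl c : V (lincomb b c) by rewrite Vb; exists c.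
have Wl c : W (lincomb w c) by rewrite Ww; exists c.
have Pb i : exists r, P (b i) r by apply: fin; left; rewrite (genE _ b i).
have Pw i : exists r, P (w i) r by apply: fin; right; rewrite (genE _ w i).
have P00 : P 0 0.
  have [r Pr] : exists r, P (lincomb w (fun=> 0)) r by apply: fin; right.
  exact: (gauge0 gP Pr).
have approx x : W x -> P x 1 -> exists2 v, V v & P (x - v) rho.
  move=> Wx Px; apply: contrapT => nv; apply: no; exists x; split=> // v Vv Pv.
  by apply: nv; exists v.
pose sepd M (x : 'I_M -> X) := [/\ forall i, exists c, x i = lincomb b c,
  forall i, P (x i) (2 * kappa) & forall i j, i != j -> ~ P (x i - x j) rho].
have bound M (x : 'I_M -> X) : sepd M x -> M%:R <= (16 * kappa ^+ 4 / rho) ^+ k.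
  move=> [x1 x2 x3].
  have := packing_bound k1 gP Pb x1 _ x2 x3; rewrite rho0 /= => /(_ _).
  have -> : 8 * kappa ^+ 3 * (2 * kappa) = 16 * kappa ^+ 4 by ring.
  by apply; move: k1 rho1; lra.
have exP : exists M, `[< exists x, sepd M x >].
  by exists 0%N; apply/asboolP; exists (fun=> 0); split=> -[].
have ubP M : `[< exists x, sepd M x >] ->
    (M <= Num.trunc ((16 * kappa ^+ 4 / rho) ^+ k))%N.
  move=> /asboolP[x /bound le]; rewrite truncn_ge_nat //.
  exact: le_trans le.
have [M /asboolP[x sx] maxM] := ex_maxnP exP ubP.
(* By maximality: a point far from every [x i] could be adjoined at the index [ord0]. *)
have near_x v : V v -> P v (2 * kappa) -> exists i, P (v - x i) rho.
  move=> Vv Pv; apply: contrapT => far.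
  have : (M.+1 <= M)%N; last by rewrite ltnn.
  apply: maxM; apply/asboolP.
  exists (fun i : 'I_M.+1 => if unlift ord0 i is Some j then x j else v).
  have [x1 x2 x3] := sx.
  split=> [i|i|i j].
  - by case: unliftP => [j _|_]; [exact: x1|move: Vv; rewrite Vb].
  - by case: unliftP => [j _|_]; [exact: x2|].
  - case: unliftP => [i' ->|->]; case: unliftP => [j' ->|->] //.
    + by rewrite (inj_eq lift_inj) => /x3.
    + by move=> _ /(gaugeN gP); rewrite opprB => Pi; apply: far; exists i'.
    + by move=> _ Pi; apply: far; exists j'.
(* The covering bound wants centres in [W], whereas the [x i] lie in [V]. Each is replaced by a
   point of [W] within [2 * kappa * rho] if there is one; otherwise its ball is never called on and
   0 is a default. *)
have /choice[y yP] (i : 'I_M) : exists y, (exists c, y = lincomb w c) /\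
    ((exists2 z, W z & P (z - x i) (2 * kappa * rho)) ->
     P (y - x i) (2 * kappa * rho)).
  have [[z Wz Pz]|nz] :=
      pselect (exists2 z, W z & P (z - x i) (2 * kappa * rho)).
    by exists z; split => //; move: Wz; rewrite Ww.
  by exists (lincomb w (fun=> 0)); split => //; exists (fun=> 0).
pose rho' := 4 * kappa ^+ 2 * rho.
have rho'0 : 0 < rho' by rewrite !mulr_gt0 // exprn_gt0.
have := @covering_bound R kappa X P n.*2 M w y rho' k1 gP Pw iw rho'0.
move=> /(_ (fun i => (yP i).1)) /(_ _ P00) cov.
have {}cov : rho' ^- n.*2 <= M%:R.
  apply: cov => c Pc; have [v Vv Pv] := approx _ (Wl c) Pc.
  have Pv2 : P v (2 * kappa).
    rewrite -[v](subKr (lincomb w c)); apply: (gauge_sub gP) Pc Pv _.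
    by rewrite mulrC ler_wpM2r ?(ltW k0) //; move: rho1; lra.
  have [i Pi] := near_x v Vv Pv2; exists i.
  have Px : P (lincomb w c - x i) (2 * kappa * rho).
    rewrite -(subrKA v); apply: (gauge_add gP) Pv Pi _.
    by rewrite le_eqVlt; apply/orP; left; apply/eqP; ring.
  have Py : P (y i - x i) (2 * kappa * rho).
    by apply: (yP i).2; exists (lincomb w c).
  rewrite -(subrKA (x i)) -[x i - y i]opprB; apply: (gauge_sub gP) Px Py _.
  by rewrite le_eqVlt; apply/orP; left; apply/eqP; rewrite /rho'; ring.
(* A base at least 1 allows the exponent [k] to be raised to [n]; taking [n]-th roots then compares
   the bases. *)
have Q1 : 1 <= 16 * kappa ^+ 4 / rho.
  rewrite ler_pdivlMr // mul1r; apply: le_trans rho1 _.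
  have : 1 <= kappa ^+ 4 by rewrite exprn_ege1.
  by lra.
have := le_trans cov (le_trans (bound _ _ sx) (ler_weXn2l Q1 kn)).
rewrite -muln2 mulnC exprM -exprVn.
rewrite ler_pXn2r ?nnegrE; last 3 first.
- exact: n0.
- by rewrite invr_ge0 exprn_ge0 // ltW.
- exact: le_trans Q1.
have -> : (rho' ^+ 2)^-1 = (16 * kappa ^+ 4 * rho)^-1 / rho.
  by rewrite /rho'; field; rewrite !gt_eqF.
have ri0 : 0 < rho^-1 by rewrite invr_gt0.
rewrite (ler_pM2r ri0) -[X in X <= _]mul1r.
rewrite ler_pdivrMr; last by rewrite !mulr_gt0 // exprn_gt0.
have -> : 16 * kappa ^+ 4 * (16 * kappa ^+ 4 * rho) = (2 * kappa)^-1.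
  by rewrite /rho; field; rewrite gt_eqF.
by rewrite invf_ge1 ?mulr_gt0 //; move: k1; lra.
Qed.

(** * Weighted sequence norms *)

Section PowerSums.
Context (R : realType).
Implicit Types a b p x y : R.

(** Two uses of [1 + t <= exp t] give [(1 - x) ^ a <= exp (- a x) <= 1 / (1 + a x)]. *)
Lemma one_sub_powR_ge a x : 0 < a -> 0 <= x <= 1 ->
  a / (1 + a) * x <= 1 - (1 - x) `^ a.
Proof.
move=> a0 /andP[x0 x1].
have xa0 : 0 <= x * a by rewrite mulr_ge0 // ltW.
have le1 : (1 - x) `^ a <= (1 + x * a)^-1.
  apply: le_trans (_ : expR (- x) `^ a <= _).
    apply: ge0_ler_powR; rewrite ?nnegrE ?expR_ge0 ?subr_ge0 //.
      exact: ltW.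
    exact: expR_ge1Dx.
  rewrite -expRM mulNr expRN lef_pV2 ?posrE ?expR_gt0 //; last by lra.
  exact: expR_ge1Dx.
have : a / (1 + a) * x <= 1 - (1 + x * a)^-1.
  have -> : 1 - (1 + x * a)^-1 = x * a / (1 + x * a) by field; lra.
  rewrite mulrAC [a * x]mulrC ler_wpM2l // lef_pV2 ?posrE; [|lra|lra].
  by rewrite lerD2l ler_piMl // ltW.
by move: le1; lra.
Qed.

(** Bernoulli's inequality for an integer [n > a]: [(1 - x) ^ a >= (1 - x) ^ n >= 1 - n x]. The
    endpoint [x = 1] is separate, as comparing exponents takes a positive base. *)
Lemma one_sub_powR_le a : 0 <= a ->
  exists2 C : R, 0 < C & forall x, 0 <= x <= 1 -> 1 - (1 - x) `^ a <= C * x.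
Proof.
move=> a0; pose n := (Num.trunc a).+1.
exists n%:R; first by rewrite ltr0n.
move=> x /andP[x0 x1].
have [->|xn1] := eqVneq x 1.
  have : 0 <= (1 - 1 : R) `^ a by exact: powR_ge0.
  have : 1 <= n%:R :> R by rewrite ler1n.
  by lra.
have x1' : 0 <= 1 - x by rewrite subr_ge0.
have := bernoulli n x1'; rewrite -powR_mulrn // => le1.
have : (1 - x) `^ n%:R <= (1 - x) `^ a.
  apply: ger_powR; last by rewrite ltW // truncnS_gt.
  by rewrite subr_gt0 lt_neqAle xn1 x1 lerBlDr lerDl.
by move: le1; lra.
Qed.

Lemma powR_succ_sub a (k : nat) : 0 < a ->
  k.+1%:R `^ a - k%:R `^ a = k.+1%:R `^ a * (1 - (1 - k.+1%:R^-1) `^ a) :> R.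
Proof.
move=> a0; rewrite mulrBr mulr1 -powRM ?subr_ge0 ?invf_le1 ?ler1n //.
by rewrite mulrBr mulr1 divff // -natr1 addrK.
Qed.

Lemma powR_telescope a (n : nat) : 0 < a ->
  n%:R `^ a = \sum_(0 <= k < n) (k.+1%:R `^ a - k%:R `^ a) :> R.
Proof.
move=> a0; rewrite (telescope_sumr (fun k => k%:R `^ a)) //.
by rewrite powR0 ?gt_eqF // subr0.
Qed.

Lemma powR_subr1 a (k : nat) : k.+1%:R `^ (a - 1) = k.+1%:R `^ a / k.+1%:R :> R.
Proof. by rewrite powRB ?pnatr_eq0 ?implybT // powRr1. Qed.

Lemma invS_itv (k : nat) : 0 <= (k.+1%:R^-1 : R) <= 1.
Proof. by rewrite invr_ge0 ler0n invf_le1 ?ler1n. Qed.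

(** Discrete form of the integral of [x ^ (a - 1)]: each term is compared with the increment of
    [k ^ a], and the increments telescope. *)
Lemma power_sum_le a : 0 < a -> exists2 C : R, 0 < C & forall n : nat,
  \sum_(0 <= k < n) k.+1%:R `^ (a - 1) <= C * n%:R `^ a.
Proof.
move=> a0; have c0 : 0 < a / (1 + a) by rewrite divr_gt0 // addr_gt0.
exists (a / (1 + a))^-1; first by rewrite invr_gt0.
move=> n; rewrite powR_telescope // mulr_sumr.
apply: ler_sum => k _; rewrite powR_succ_sub // powR_subr1.
rewrite mulrCA ler_wpM2l ?powR_ge0 // ler_pdivlMl //.
exact: one_sub_powR_ge (invS_itv k).
Qed.

Lemma power_sum_ge a : 0 < a -> exists2 C : R, 0 < C & forall n : nat,
  n%:R `^ a <= C * \sum_(0 <= k < n) k.+1%:R `^ (a - 1).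
Proof.
move=> a0; have [C C0 hC] := one_sub_powR_le (ltW a0).
exists C => // n; rewrite powR_telescope // mulr_sumr.
apply: ler_sum => k _; rewrite powR_succ_sub // powR_subr1.
by rewrite mulrCA ler_wpM2l ?powR_ge0 // hC // invS_itv.
Qed.

(** Comparison with the decrements of [(k + 1) ^ (- b)], which telescope; the factor 2 comes from
    [1 / (k + 1) <= 2 / (k + 2)]. *)
Lemma power_tail_le b : 0 < b -> exists2 C : R, 0 < C & forall n N : nat,
  \sum_(n <= k < n + N) k.+1%:R `^ (- b - 1) <= C * n.+1%:R `^ (- b).
Proof.
move=> b0; pose c := b / (1 + b).
have c0 : 0 < c by rewrite divr_gt0 // addr_gt0.
have c20 : 0 < 2 / c by exact: divr_gt0.
exists (2 / c) => // n N; pose v (k : nat) : R := - k.+1%:R `^ (- b).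
apply: le_trans (_ : 2 / c * (v (n + N)%N - v n) <= _); last first.
  rewrite ler_pM2l // /v opprK gerDr oppr_le0.
  exact: powR_ge0.
rewrite -(telescope_sumr v) ?leq_addr // mulr_sumr; apply: ler_sum => k _.
rewrite powR_subr1 /v opprK [- _ + _]addrC.
have -> : k.+2%:R `^ (- b) = k.+1%:R `^ (- b) * (1 - k.+2%:R^-1) `^ b :> R.
  have -> : 1 - k.+2%:R^-1 = k.+1%:R / k.+2%:R :> R.
    by rewrite -[k.+1%:R](addrK 1) natr1 mulrBl divff ?pnatr_eq0 // mul1r.
  rewrite powRM ?invr_ge0 // mulrA -powRD ?pnatr_eq0 ?implybT //.
  rewrite addNr powRr0 mul1r -powR_inv1 // -powRrM.
  by congr (_ `^ _); rewrite mulN1r.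
rewrite -[X in X - _]mulr1 -mulrBr mulrCA ler_wpM2l ?powR_ge0 //.
apply: le_trans (_ : 2 / c * (c * k.+2%:R^-1) <= _); last first.
  by rewrite ler_pM2l // one_sub_powR_ge // invS_itv.
rewrite mulrA divfK ?gt_eqF // ler_pdivlMr // ler_pdivrMl //.
rewrite -(natr1 k.+1); have : 1 <= k.+1%:R :> R by rewrite ler1n.
by lra.
Qed.
End PowerSums.

(* [seqnorm_le r q e x] says that the norm defining [A^r_q], evaluated at the
   sequence of errors [e], is at most [x]. *)
Definition seqnorm_le (R : realType) (r : R) (q : \bar R) (e : nat -> R) (x : R)
    : Prop :=
  match q with
  | p%:E => forall n, \sum_(0 <= k < n)
      ((k.+1%:R `^ r * e k) `^ p) * k.+1%:R^-1 <= x `^ p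
  | +oo%E => forall k, k.+1%:R `^ r * e k <= x
  | -oo%E => True
  end.

Section SeqNorm.
Context (R : realType).
Implicit Types (p r s x t : R) (q : \bar R) (e : nat -> R).

Lemma ler_powRl p x y : 0 <= p -> 0 <= x -> x <= y -> x `^ p <= y `^ p.
Proof.
move=> p0 x0 xy; apply: ge0_ler_powR => //; rewrite nnegrE //.
exact: le_trans xy.
Qed.

Lemma powR_rootK p C : 0 < p -> 0 <= C -> (C `^ p^-1) `^ p = C.
Proof. by move=> p0 C0; rewrite -powRrM mulVf ?gt_eqF // powRr1. Qed.

Lemma powRK p x : 0 < p -> 0 <= x -> (x `^ p) `^ p^-1 = x.
Proof. by move=> p0 x0; rewrite -powRrM divff ?gt_eqF // powRr1. Qed.

Lemma powR_root_le p C u x : 0 < p -> 0 <= u -> 0 <= C -> 0 <= x ->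
  u `^ p <= C * x `^ p -> u <= C `^ p^-1 * x.
Proof.
move=> p0 u0 C0 x0 le.
have := ler_powRl (p := p^-1) _ (powR_ge0 _ _) le.
rewrite invr_ge0 (ltW p0) => /(_ isT).
by rewrite powRM ?powR_ge0 // !powRK.
Qed.

Lemma seq_termE p r x (k : nat) : 0 <= x ->
  ((k.+1%:R `^ r * x) `^ p) * k.+1%:R^-1 = x `^ p * k.+1%:R `^ (r * p - 1) :> R.
Proof.
by move=> x0; rewrite powRM ?powR_ge0 // -powRrM powR_subr1 mulrAC mulrC mulrA.
Qed.

Lemma seqnorm_le_weaken r q e x y : (0 < q)%E -> 0 <= x -> x <= y ->
  seqnorm_le r q e x -> seqnorm_le r q e y.
Proof.
case: q => [p p0|_|//] x0 xy h n /=; last exact: le_trans xy.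
by apply: le_trans (h n) _; apply: ler_powRl => //; exact: ltW.
Qed.

Lemma seqnorm_le_scale r q a e e' x : (0 < q)%E -> 0 <= a -> 0 <= x ->
  (forall k, 0 <= e k <= a * e' k) -> (forall k, 0 <= e' k) ->
  seqnorm_le r q e' x -> seqnorm_le r q e (a * x).
Proof.
case: q => [p p0|_|//] a0 x0 ee' e'0 h n /=.
  have p0' : 0 <= p by exact: ltW.
  rewrite powRM //; apply: le_trans (ler_wpM2l (powR_ge0 a p) (h n)).
  rewrite mulr_sumr; apply: ler_sum => k _; have /andP[e0 le] := ee' k.
  rewrite !seq_termE // mulrA ler_wpM2r ?powR_ge0 // -powRM //.
  exact: ler_powRl.
have /andP[e0 le] := ee' n.
apply: le_trans (ler_wpM2l a0 (h n)).
by rewrite mulrCA ler_wpM2l ?powR_ge0.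
Qed.

(** Bounding a sum by twice the maximum gives [(u + v) ^ p <= 2 ^ p * (u ^ p + v ^ p)] for [p] on
    either side of 1. *)
Lemma seqnorm_le_add q : (0 < q)%E -> exists2 C : R, 0 < C & forall r e e' x,
  0 <= x -> (forall k, 0 <= e k) -> (forall k, 0 <= e' k) ->
  seqnorm_le r q e x -> seqnorm_le r q e' x ->
  seqnorm_le r q (fun k => e k + e' k) (C * x).
Proof.
case: q => [p p0|_|//]; last first.
  exists 2 => // r e e' x _ _ _ h h' k.
  by rewrite /= mulrDr; move: (h k) (h' k) => /=; lra.
have {}p0 : 0 < p by [].
have p0' : 0 <= p by exact: ltW.
exists (2 * 2 `^ p^-1); first by rewrite mulr_gt0 // powR_gt0.
move=> r e e' x x0 e0 e'0 h h' n /=.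
rewrite !powRM ?mulr_ge0 ?powR_ge0 // powR_rootK //.
apply: le_trans (_ : 2 `^ p * (x `^ p + x `^ p) <= _); last first.
  by rewrite -mulrA mulr_natl.
apply: le_trans (ler_wpM2l (powR_ge0 2 p) (lerD (h n) (h' n))).
rewrite -big_split /= mulr_sumr; apply: ler_sum => k _.
rewrite !seq_termE ?addr_ge0 // -mulrDl mulrA ler_wpM2r ?powR_ge0 //.
have max_le u v : 0 <= u -> u <= v ->
    (u + v) `^ p <= 2 `^ p * (u `^ p + v `^ p).
  move=> u0 uv; apply: le_trans (_ : (2 * v) `^ p <= _).
    by apply: ler_powRl; lra.
  by rewrite powRM ?ler_wpM2l ?powR_ge0 ?lerDr ?powR_ge0 //; exact: le_trans uv.
have [le|/ltW le] := leP (e k) (e' k); first exact: max_le.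
by rewrite addrC [X in _ * X]addrC; exact: max_le.
Qed.

(** Embedding of [A^r_q] into [A^r_oo]: by monotonicity [e n] may replace [e k] in the first [n + 1]
    terms, and [power_sum_ge] sums the weights. *)
Lemma seqnorm_le_decr r q : 0 < r -> (0 < q)%E -> exists2 C : R, 0 < C &
  forall e x, 0 <= x -> (forall k, 0 <= e k) ->
  (forall k n, (k <= n)%N -> e n <= e k) -> seqnorm_le r q e x ->
  forall n, n.+1%:R `^ r * e n <= C * x.
Proof.
move=> r0; case: q => [p p0|_|//]; last first.
  by exists 1 => // e x _ _ _ h n; rewrite mul1r; exact: h.
have {}p0 : 0 < p by [].
have p0' : 0 <= p by exact: ltW.
have [C C0 hC] := power_sum_ge (mulr_gt0 r0 p0).
exists (C `^ p^-1); first exact: powR_gt0.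
move=> e x x0 e0 de h n.
apply: powR_root_le => //; [by rewrite mulr_ge0 // powR_ge0|exact: ltW|].
apply: le_trans (ler_wpM2l (ltW C0) (h n.+1)).
rewrite powRM ?powR_ge0 // -powRrM.
apply: le_trans (ler_wpM2r (powR_ge0 _ _) (hC n.+1)) _.
rewrite -mulrA ler_wpM2l ?(ltW C0) // mulr_suml.
rewrite big_nat_cond [leRHS]big_nat_cond.
apply: ler_sum => k /andP[/andP[_ kn] _].
by rewrite seq_termE // mulrC ler_wpM2r ?powR_ge0 // ler_powRl // de.
Qed.

(** Models the errors of [f - g] for [g] in [X_n]: flat up to [n], then of order [m ^ (- s)]. Head
    and tail contribute the same order, the head because [r > 0] and the tail because [r < s]. *)
Lemma seqnorm_le_profile r s q : 0 < r -> r < s -> (0 < q)%E ->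
  exists2 C : R, 0 < C & forall (n : nat) e t, 0 <= t ->
  (forall m, 0 <= e m <= t * (maxn m n).+1%:R `^ (- s)) ->
  seqnorm_le r q e (C * (t * n.+1%:R `^ (- (s - r)))).
Proof.
move=> r0 rs; case: q => [p p0|_|//]; last first.
  exists 1 => // n e t t0 h m; rewrite mul1r; have /andP[e0 le] := h m.
  apply: le_trans (ler_wpM2l (powR_ge0 _ _) le) _.
  rewrite mulrCA ler_wpM2l //.
  apply: le_trans (_ : (maxn m n).+1%:R `^ r * (maxn m n).+1%:R `^ (- s) <= _).
    rewrite ler_wpM2r ?powR_ge0 // ler_powRl ?(ltW r0) // ler_nat ltnS.
    exact: leq_maxl.
  rewrite -powRD ?pnatr_eq0 ?implybT // opprB.
  rewrite -[r - s]opprB !powRN lef_pV2 ?posrE ?powR_gt0 //.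
  by rewrite ler_powRl ?subr_ge0 ?(ltW rs) // ler_nat ltnS leq_maxr.
have {}p0 : 0 < p by [].
have p0' : 0 <= p by exact: ltW.
have [C1 C10 h1] := power_sum_le (mulr_gt0 r0 p0).
have sr0 : 0 < (s - r) * p by rewrite mulr_gt0 // subr_gt0.
have [C2 C20 h2] := power_tail_le sr0.
exists ((C1 + C2) `^ p^-1); first by rewrite powR_gt0 // addr_gt0.
move=> n e t t0 h N.
rewrite powRM ?powR_ge0 ?mulr_ge0 ?powR_ge0 //.
rewrite powR_rootK ?addr_ge0 ?(ltW C10) ?(ltW C20) //.
have sr : - (s - r) * p = - ((s - r) * p) by rewrite mulNr.
rewrite powRM ?powR_ge0 // -powRrM sr.
(* The range is enlarged so that it can be split at [n]. *)
apply: le_trans (_ : \sum_(0 <= k < n + N)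
    ((k.+1%:R `^ r * e k) `^ p) * k.+1%:R^-1 <= _).
  rewrite (big_cat_nat (leq0n N) (leq_addl n N)) /= lerDl.
  by apply: sumr_ge0 => k _; rewrite mulr_ge0 ?powR_ge0.
rewrite (big_cat_nat (leq0n n) (leq_addr N n)) /= mulrDl; apply: lerD.
  apply: le_trans (_ : \sum_(0 <= k < n) t `^ p * n.+1%:R `^ (- s * p) *
      k.+1%:R `^ (r * p - 1) <= _).
    rewrite big_nat_cond [leRHS]big_nat_cond.
    apply: ler_sum => k /andP[/andP[_ kn] _]; have /andP[e0 le] := h k.
    rewrite seq_termE // ler_wpM2r ?powR_ge0 //.
    rewrite (maxn_idPr (ltnW kn)) in le.
    by rewrite powRrM -powRM ?powR_ge0 // ler_powRl.
  rewrite -mulr_sumr.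
  apply: le_trans (ler_wpM2l _ (h1 n)) _; first by rewrite mulr_ge0 ?powR_ge0.
  rewrite mulrCA ler_wpM2l ?(ltW C10) // -mulrA ler_wpM2l ?powR_ge0 //.
  apply: le_trans (_ : n.+1%:R `^ (- s * p) * n.+1%:R `^ (r * p) <= _).
    by rewrite ler_wpM2l ?powR_ge0 // ler_powRl ?ler_nat // mulr_ge0 // ltW.
  rewrite -powRD ?pnatr_eq0 ?implybT //.
  by rewrite le_eqVlt; apply/orP; left; apply/eqP; congr (_ `^ _); ring.
apply: le_trans (_ : \sum_(n <= k < n + N) t `^ p *
    k.+1%:R `^ (- ((s - r) * p) - 1) <= _).
  rewrite big_nat_cond [leRHS]big_nat_cond.
  apply: ler_sum => k /andP[/andP[nk _] _]; have /andP[e0 le] := h k.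
  rewrite (maxn_idPl nk) in le.
  rewrite seq_termE //.
  have -> : - ((s - r) * p) - 1 = - s * p + (r * p - 1) by ring.
  rewrite [X in _ <= _ * X]powRD ?pnatr_eq0 ?implybT //.
  by rewrite mulrA ler_wpM2r ?powR_ge0 // powRrM -powRM ?powR_ge0 // ler_powRl.
rewrite -mulr_sumr mulrCA ler_wpM2l ?powR_ge0 //; exact: h2.
Qed.

(** A sequence that vanishes beyond [n] lies under a profile with decay exponent [r + 1]. *)
Lemma seqnorm_le_trunc r q : 0 < r -> (0 < q)%E -> exists2 C : R, 0 < C &
  forall (n : nat) e t, 0 <= t -> (forall m, 0 <= e m <= t) ->
  (forall m, (n < m)%N -> e m = 0) -> seqnorm_le r q e (C * (t * n.+1%:R `^ r)).
Proof.
move=> r0 q0; have rr1 : r < r + 1 by rewrite ltrDl.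
have [C C0 hC] := seqnorm_le_profile r0 rr1 q0.
exists C => // n e t t0 het e0.
have -> : t * n.+1%:R `^ r =
    t * n.+1%:R `^ (r + 1) * n.+1%:R `^ (- (r + 1 - r)).
  rewrite -mulrA -powRD ?pnatr_eq0 ?implybT //; congr (_ * _ `^ _); ring.
apply: hC => [|m]; first by rewrite mulr_ge0 // powR_ge0.
have /andP[em0 le] := het m; rewrite em0 andTb.
have [mn|nm] := leqP m n.
  rewrite -mulrA -powRD ?pnatr_eq0 ?implybT //.
  by rewrite subrr powRr0 mulr1.
by rewrite e0 // !mulr_ge0 // powR_ge0.
Qed.

Lemma seqnorm_le_shift r r' q e x :
  seqnorm_le (r - r') q (fun k => k.+1%:R `^ r' * e k) x -> seqnorm_le r q e x.
Proof.
have E (k : nat) : k.+1%:R `^ (r - r') * (k.+1%:R `^ r' * e k) =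
    k.+1%:R `^ r * e k.
  by rewrite mulrA -powRD ?pnatr_eq0 ?implybT // subrK.
case: q => [p|//|//] h n /=; last by rewrite -E; exact: h.
by apply: le_trans (h n); apply: ler_sum => k _; rewrite E.
Qed.

Lemma seqnorm_le_head r q e x : (0 < q)%E -> 0 <= x -> (forall k, 0 <= e k) ->
  seqnorm_le r q e x -> e 0%N <= x.
Proof.
case: q => [p p0|_|//] x0 e0 h; last by have := h 0%N; rewrite powR1 mul1r.
have {}p0 : 0 < p by [].
have := h 1%N; rewrite big_nat1 powR1 mul1r invr1 mulr1 => le.
by have := powR_root_le p0 (e0 0%N) ler01 x0; rewrite !mul1r powR1 mul1r; apply.
Qed.
End SeqNorm.

(** * Approximation spaces *)

(** Turns the extended-real norm into real bounds on partial sums or terms, where the sequence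
    estimates apply. *)
Lemma approx_norm_leP (R : realType) (X : lmodType R) (N : X -> R)
    (XX : nat -> set X) (r : R) (q : \bar R) (f : X) (x : R) :
  (0 < q)%E -> 0 <= x -> (approx_norm N XX r q f <= x%:E)%E <->
  seqnorm_le r q (fun n => best_approx N XX n f) x.
Proof.
case: q => [p p0|_|//] x0 /=; last first.
  split=> [h k|h].
    by rewrite -lee_fin; apply: le_trans h; apply: ereal_sup_ubound; exists k.
  by apply: ge_ereal_sup => _ [k _ <-]; rewrite lee_fin.
have {}p0 : 0 < p by [].
have t0 k : (0 <= (((k.+1%:R `^ r * best_approx N XX k f) `^ p) *
    k.+1%:R^-1 : R)%:E)%E by rewrite lee_fin mulr_ge0 ?powR_ge0.
set S := (\sum_(0 <= n <oo) _)%E.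
have S0 : (0 <= S)%E by apply: nneseries_ge0.
have SE : (S <= (x `^ p)%:E)%E <-> (S `^ p^-1 <= x%:E)%E.
  case: S S0 => [s| |] //.
    rewrite poweR_EFin !lee_fin => s0; split=> le.
      by rewrite -[x](powRK p0) // ler_powRl // invr_ge0 ltW.
    rewrite -[s](powR_rootK p0 s0); apply: ler_powRl => //; first exact: ltW.
    exact: powR_ge0.
  by rewrite poweRyr ?invr_eq0 ?gt_eqF.
rewrite -SE; split=> [h n|h].
  rewrite -lee_fin; apply: le_trans h; rewrite -sumEFin.
  exact: nneseries_lim_ge.
apply: lime_le; first exact: is_cvg_nneseries.
by apply: nearW => n; rewrite sumEFin lee_fin.
Qed.

Lemma approx_norm_ge0 (R : realType) (X : lmodType R) (N : X -> R)
    (XX : nat -> set X) (r : R) (q : \bar R) (f : X) :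
  (forall n, 0 <= best_approx N XX n f) -> (0 < q)%E ->
  (0 <= approx_norm N XX r q f)%E.
Proof.
move=> E0; case: q => [p _|_|//] /=; first exact: poweR_ge0.
apply: (@le_trans _ _ (1%:R `^ r * best_approx N XX 0 f)%:E).
  rewrite lee_fin; apply: mulr_ge0 (E0 _); exact: powR_ge0.
by apply: ereal_sup_ubound; exists 0%N.
Qed.

Lemma quasi_banach_weaken (R : realType) (kappa kappa' : R) (X : lmodType R)
    (N : X -> R) :
  kappa <= kappa' -> quasi_banach kappa N -> quasi_banach kappa' N.
Proof.
move=> kk [h1 h2 h3 h4 h5]; split=> // x y; apply: le_trans (h4 x y) _.
by rewrite ler_wpM2r // addr_ge0.
Qed.

Section BestApprox.
Context (R : realType) (kappa : R) (X : lmodType R) (N : X -> R)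
  (XX : nat -> set X).
Hypotheses (k1 : 1 <= kappa) (qN : quasi_banach kappa N)
  (sX : approximation_scheme N XX).

Let k0 : 0 < kappa. Proof. exact: lt_le_trans k1. Qed.

Local Notation E := (best_approx N XX).

Lemma qnorm0 : N 0 = 0.
Proof. by rewrite -(scale0r (0 : X)) (qnormZ qN) normr0 mul0r. Qed.

Lemma qnormN x : N (- x) = N x.
Proof. by rewrite -scaleN1r (qnormZ qN) normrN1 mul1r. Qed.

Lemma gauge_qnorm : gauge kappa (fun x r => ((N x)%:E <= r%:E)%E).
Proof.
split=> [x r|x r r'|a x r|x y r t|x] /=; rewrite ?lee_fin.
- exact: le_trans (qnorm_ge0 qN x).
- exact: le_trans.
- by move=> le; rewrite (qnormZ qN) ler_wpM2l.
- move=> xr yt; apply: le_trans (qnormD qN x y) _.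
  by rewrite ler_pM2l // lerD.
- move=> h; apply: (qnorm_eq0 qN); apply/eqP.
  rewrite eq_le (qnorm_ge0 qN) andbT.
  by apply/ler_addgt0Pr => e e0; rewrite add0r -lee_fin h.
Qed.

Lemma has_dim_span (V : set X) n : has_dim V n -> [/\ V 0,
  forall x y, V x -> V y -> V (x + y) & forall a x, V x -> V (a *: x)].
Proof.
move=> [b [_ ->]]; split=> [|_ _ [c ->] [d ->]|a _ [c ->]].
- by exists (fun=> 0); rewrite big1 // => i _; rewrite scale0r.
- exists (fun i => c i + d i); exact/esym/lincombD.
- exists (fun i => a * c i); exact/esym/lincombZ.
Qed.

Lemma scheme0 n : XX n 0.
Proof. by have [] := has_dim_span (scheme_dim sX n). Qed.

Lemma schemeD n x y : XX n x -> XX n y -> XX n (x + y).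
Proof. by have [_ h _] := has_dim_span (scheme_dim sX n); apply: h. Qed.

Lemma schemeZ n a x : XX n x -> XX n (a *: x).
Proof. by have [_ _ h] := has_dim_span (scheme_dim sX n); apply: h. Qed.

Lemma scheme_le m n : (m <= n)%N -> XX m `<=` XX n.
Proof.
move=> /subnKC <-; elim: (n - m)%N => [|k IH]; first by rewrite addn0.
by rewrite addnS; apply: subset_trans IH _; exact: scheme_nested sX _.
Qed.

Lemma scheme_0E x : XX 0 x -> x = 0.
Proof.
by have [b [_ ->]] := scheme_dim sX 0 => -[c ->]; rewrite big_ord0.
Qed.

Lemma best_approx_has_inf n f : has_inf [set N (f - g) | g in XX n].
Proof.
split; first by exists (N (f - 0)), 0 => //; exact: scheme0.
by exists 0 => _ [g _ <-]; exact: qnorm_ge0 qN _.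
Qed.

Lemma best_approx_ge0 n f : 0 <= E n f.
Proof.
apply: lb_le_inf; first by have [] := best_approx_has_inf n f.
by move=> _ [g _ <-]; exact: qnorm_ge0 qN _.
Qed.

Lemma best_approx_le n f g : XX n g -> E n f <= N (f - g).
Proof.
by move=> Xg; apply: ge_inf; [have [] := best_approx_has_inf n f|exists g].
Qed.

Lemma near_best_approx n f e :
  0 < e -> exists2 g, XX n g & N (f - g) < E n f + e.
Proof.
by move=> e0; have [_ [g Xg <-]] := inf_adherent e0 (best_approx_has_inf n f);
  exists g.
Qed.

Lemma best_approx_decr f k n : (k <= n)%N -> E n f <= E k f.
Proof.
move=> kn; apply: lb_le_inf; first by have [] := best_approx_has_inf k f.
by move=> _ [g Xg <-]; apply: best_approx_le; exact: scheme_le Xg.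
Qed.

Lemma best_approx_le_qnorm n f : E n f <= N f.
Proof.
by rewrite -[in leRHS](subr0 f); apply: best_approx_le; exact: scheme0.
Qed.

Lemma best_approx0 f : E 0 f = N f.
Proof.
apply/eqP; rewrite eq_le best_approx_le_qnorm /=; apply: lb_le_inf.
  by have [] := best_approx_has_inf 0 f.
by move=> _ [g /scheme_0E -> <-]; rewrite subr0.
Qed.

Lemma best_approx_eq0 n f : XX n f -> E n f = 0.
Proof.
move=> Xf; apply/eqP; rewrite eq_le best_approx_ge0 andbT.
by apply: le_trans (best_approx_le f Xf) _; rewrite subrr qnorm0.
Qed.

Lemma best_approxD n f h : E n (f + h) <= kappa * (E n f + E n h).
Proof.
apply/ler_addgt0Pr => e e0; pose d := e / (2 * kappa).
have d0 : 0 < d by rewrite divr_gt0 // mulr_gt0.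
have [g Xg gE] := near_best_approx n f d0.
have [g' Xg' g'E] := near_best_approx n h d0.
apply: le_trans (best_approx_le (f + h) (schemeD Xg Xg')) _.
rewrite opprD addrACA; apply: le_trans (qnormD qN _ _) _.
apply: le_trans (_ : kappa * (E n f + d + (E n h + d)) <= _).
  by rewrite ler_pM2l // lerD // ltW.
rewrite le_eqVlt; apply/orP; left; apply/eqP.
by rewrite /d; field; rewrite gt_eqF.
Qed.

Lemma best_approxZ n a f : E n (a *: f) <= `|a| * E n f.
Proof.
apply/ler_addgt0Pr => e e0; pose d := e / (`|a| + 1).
have a1 : 0 < `|a| + 1 by rewrite ltr_wpDl.
have d0 : 0 < d by rewrite divr_gt0.
have [g Xg gE] := near_best_approx n f d0.
apply: le_trans (best_approx_le (a *: f) (schemeZ a Xg)) _.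
rewrite -scalerBr (qnormZ qN).
apply: le_trans (ler_wpM2l (normr_ge0 a) (ltW gE)) _.
rewrite mulrDr lerD2l /d mulrCA ler_piMr ?(ltW e0) //.
by rewrite ler_pdivrMr // mul1r lerDl.
Qed.

Lemma best_approx_sub_le n f g : XX n g -> E n (f - g) <= E n f.
Proof.
move=> Xg; apply: lb_le_inf; first by have [] := best_approx_has_inf n f.
move=> _ [h Xh <-].
have -> : f - h = f - g - (h - g) by rewrite opprB addrA subrK.
apply: best_approx_le; rewrite -scaleN1r in Xg *.
exact: schemeD Xh (schemeZ _ Xg).
Qed.

Lemma approx_norm_dilate r q a f x : (0 < q)%E -> 0 <= x ->
  (approx_norm N XX r q f <= x%:E)%E ->
  (approx_norm N XX r q (a *: f) <= (`|a| * x)%:E)%E.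
Proof.
move=> q0 x0 /(approx_norm_leP _ _ _ _ q0 x0) h.
apply/approx_norm_leP => //; first exact: mulr_ge0.
apply: seqnorm_le_scale h => // [k|k]; last exact: best_approx_ge0.
by rewrite best_approx_ge0 best_approxZ.
Qed.

Lemma approx_norm_fin r q n f : 0 < r -> (0 < q)%E -> XX n f ->
  exists x, (approx_norm N XX r q f <= x%:E)%E.
Proof.
move=> r0 q0 Xf; have [C C0 hC] := seqnorm_le_trunc r0 q0.
exists (C * (N f * n.+1%:R `^ r)).
apply/approx_norm_leP => //.
  by rewrite !mulr_ge0 ?(ltW C0) ?powR_ge0 // (qnorm_ge0 qN).
apply: hC => [|m|m nm]; first exact: qnorm_ge0 qN _.
  by rewrite best_approx_ge0 best_approx_le_qnorm.
by apply: best_approx_eq0; exact: scheme_le (ltnW nm) _ Xf.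
Qed.
End BestApprox.

(** The constant [kappa'] is fixed before the space, so that the lower constant in (ii) sees the
    space only through [kappa]. Definiteness comes from the term [E_0 = N]. *)
Lemma gauge_approx_norm (R : realType) (kappa r : R) (q : \bar R) :
  1 <= kappa -> (0 < q)%E -> exists2 kappa' : R, 1 <= kappa' &
  forall (X : lmodType R) (N : X -> R) (XX : nat -> set X),
  quasi_banach kappa N -> approximation_scheme N XX ->
  gauge kappa' (fun x t => (approx_norm N XX r q x <= t%:E)%E).
Proof.
move=> k1 q0; have [C C0 hC] := seqnorm_le_add q0.
exists (Num.max 1 (kappa * C)); first by rewrite le_max lexx.
move=> X N XX qN sX.
have E0 f n := best_approx_ge0 qN sX n f.
have ge0 f t : (approx_norm N XX r q f <= t%:E)%E -> 0 <= t.
  by rewrite -lee_fin; apply: le_trans; exact: approx_norm_ge0 (E0 f) q0.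
split=> [|x t t' h tt|a x t h|x y t u hx hy|x h].
- exact: ge0.
- by apply: le_trans h _; rewrite lee_fin.
- by apply: (approx_norm_dilate qN sX) => //; exact: ge0 h.
- have t0 := ge0 _ _ hx; have u0 := ge0 _ _ hy; have tu0 := addr_ge0 t0 u0.
  have k0 : 0 <= kappa by exact: le_trans k1.
  have kC0 : 0 <= kappa * (C * (t + u)) by rewrite !mulr_ge0 // ltW.
  apply: le_trans (_ : (kappa * (C * (t + u)))%:E <= _)%E; last first.
    by rewrite lee_fin mulrA ler_wpM2r // le_max lexx orbT.
  apply/approx_norm_leP => //.
  apply: (seqnorm_le_scale (e' := fun k => best_approx N XX k x +
    best_approx N XX k y)) => // [|k|k|].
  + by rewrite mulr_ge0 // ltW.
  + by rewrite E0 (best_approxD k1 qN sX).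
  + by rewrite addr_ge0.
  + apply: hC => //.
    * apply: seqnorm_le_weaken (iffLR (approx_norm_leP _ _ _ _ q0 t0) hx) => //.
      by rewrite lerDl.
    * apply: seqnorm_le_weaken (iffLR (approx_norm_leP _ _ _ _ q0 u0) hy) => //.
      by rewrite lerDr.
- apply: (gauge_eq0 (gauge_qnorm k1 qN)) => e e0.
  rewrite lee_fin -(best_approx0 qN sX).
  by have /(approx_norm_leP _ _ _ _ q0 (ltW e0))/seqnorm_le_head := h e e0;
    apply => //; exact: ltW.
Qed.

(** * Widths of the unit ball *)

(** A point far from all of [V] is far from its constrained part. Using [gauge_width_lb] at [n + 1]
    includes [n = 0], whence the dimension of [W]. *)
Lemma width_ge (R : realType) (kappa : R) (X : lmodType R) (M : X -> \bar R)
    (gamma a : R) (K W : set X) (n : nat) :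
  1 <= kappa -> gauge kappa (fun x r => (M x <= r%:E)%E) ->
  has_dim W (n.+1).*2 -> (forall x, W x -> exists r, (M x <= r%:E)%E) ->
  0 < a -> (forall x, W x -> (M x <= 1)%E -> K (a *: x)) ->
  ((((2 * kappa) ^- 9) * a)%:E <= constrained_width M gamma K n)%E.
Proof.
move=> k1 gM dW finW a0 WK; set delta := _^-1.
have lower V : dim_le V n -> (forall x, V x -> exists r, (M x <= r%:E)%E) ->
    exists2 f, K f & forall v, V v -> ((delta * a)%:E <= M (f - v)%R)%E.
  move=> [m mn dV] finV.
  have fin x : V x \/ W x -> exists r, (M x <= r%:E)%E by case=> ?; auto.
  have [x [Wx Mx far]] := gauge_width_lb k1 gM (ltn0Sn n)
    (ex_intro2 _ _ m (leqW mn) dV) dW fin.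
  exists (a *: x); first exact: WK.
  move=> v Vv; rewrite leNgt; apply/negP => /ltW lt.
  have [_ _ VZ] := has_dim_span dV.
  apply: (far _ (VZ a^-1 v Vv)); apply: (gauge_unscale gM a0).
  by rewrite scalerBr scalerA mulfV ?gt_eqF // scale1r mulrC.
have fin0 x : (M x < +oo)%E -> exists r, (M x <= r%:E)%E.
  by case: (M x) => [s _||_] //; [exists s|exists 0; rewrite leNye].
(* At index 0 the width is a supremum of [M], treated as the distance to the subspace [{0}]. *)
case: n => [|n] in dW lower *.
  have [f Kf far] : exists2 f, K f & forall v, [set 0] v ->
      ((delta * a)%:E <= M (f - v)%R)%E.
    apply: lower => [|_ ->].
      exists 0%N => //; exists (fun _ => 0); split=> [c _ []//|].
      by apply/seteqP; split=> [_ ->|x [c ->]]; [exists (fun=> 0)|];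
        rewrite big_ord0.
    by apply: finW; have [] := has_dim_span dW.
  apply: le_ereal_sup_tmp; exists (M f); first by exists f.
  by have := far 0 erefl; rewrite subr0.
apply: le_ereal_inf_tmp => _ [V [dV finV] <-].
have [x Vx|f Kf far] := lower V dV; first by apply: fin0; exact: finV.
apply: le_ereal_sup_tmp; eexists; first by exists f.
by apply: le_ereal_inf_tmp => _ [v [Vv _] <-]; exact: far.
Qed.

Lemma width_le (R : realType) (X : lmodType R) (M : X -> \bar R)
    (gamma : R) (K V : set X) (n : nat) (D : \bar R) :
  has_dim V n -> V `<=` [set v | (M v < +oo)%E] ->
  (forall f, K f -> exists v,
    [/\ V v, dilates K gamma v & (M (f - v)%R <= D)%E]) ->
  (constrained_width M gamma K n <= D)%E.
Proof.
move=> dV finV apx; case: n => [|n] in dV *.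
  apply: ge_ereal_sup => _ [f Kf <-]; have [v [Vv _]] := apx f Kf.
  have [b [_ VE]] := dV; move: Vv; rewrite VE => -[c ->].
  by rewrite big_ord0 subr0.
apply: ge_ereal_inf; eexists.
  by exists V => //; split => //; exists n.+1.
apply: ge_ereal_sup => _ [f Kf <-]; have [v [Vv Kv le]] := apx f Kf.
by apply: ge_ereal_inf; exists (M (f - v)) => //; exists v.
Qed.

(* The near-best approximant [g] of [f] from [X_n] satisfies
   [E_m(g) <= kappa (2 E_m(f) + eps)] for [m <= n], so it is in a fixed multiple
   of the ball. *)
Lemma constrained_near_best (R : realType) (s kappa : R) (q : \bar R) :
  0 < s -> (0 < q)%E -> 1 <= kappa -> exists2 gamma0 : R, 1 <= gamma0 &
  forall (X : lmodType R) (N : X -> R) (XX : nat -> set X),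
  quasi_banach kappa N -> approximation_scheme N XX ->
  forall gamma, gamma0 <= gamma -> forall n f, approx_ball N XX s q f ->
  exists g, [/\ XX n g, dilates (approx_ball N XX s q) gamma g &
    N (f - g) <= best_approx N XX n f + n.+1%:R `^ (- s)].
Proof.
move=> s0 q0 k1; have k0 : 0 <= kappa by exact: le_trans k1.
have [Ca Ca0 hCa] := seqnorm_le_add q0.
have [Ct Ct0 hCt] := seqnorm_le_trunc s0 q0.
exists (Num.max 1 (kappa * (Ca * (2 + Ct)))); first by rewrite le_max lexx.
move=> X N XX qN sX gamma; rewrite ge_max => /andP[g1 gC] n f Kf.
have g0 : 0 < gamma by exact: lt_le_trans g1.
have E0 m h := best_approx_ge0 qN sX m h.
(* Since [e * (n + 1) ^ s = 1], the truncated constant sequence [u] below has norm at most [Ct]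
   whatever [n] is. *)
pose e : R := n.+1%:R `^ (- s); have e0 : 0 < e by exact: powR_gt0.
have [g Xg /ltW gE] := near_best_approx qN sX n f e0.
exists g; split => //.
exists gamma; split; first by rewrite (ltW g0) lexx.
exists (gamma^-1 *: g); last by rewrite scalerA divff ?gt_eqF // scale1r.
rewrite /approx_ball /=.
have -> : 1%E = (`|gamma^-1| * gamma)%:E :> \bar R.
  by rewrite ger0_norm ?invr_ge0 ?(ltW g0) // mulVf ?gt_eqF.
apply: (approx_norm_dilate qN sX) => //; first exact: ltW.
apply/approx_norm_leP => //; first exact: ltW.
apply: (seqnorm_le_weaken q0 _ gC).
  by rewrite !mulr_ge0 ?(ltW Ca0) // addr_ge0 // ltW.
pose u m := if (m <= n)%N then e else 0.
apply: (seqnorm_le_scale q0 k0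
  (e' := fun m => 2 * best_approx N XX m f + u m)).
- by rewrite mulr_ge0 ?(ltW Ca0) // addr_ge0 // ltW.
- move=> m; rewrite E0 /= /u.
  have [mn|/ltnW nm] := leqP m n; last first.
    rewrite (best_approx_eq0 qN sX (scheme_le sX nm Xg)).
    by rewrite mulr_ge0 // addr_ge0 // mulr_ge0.
  (* The factor 2 arises from [E_m(f - g) <= N(f - g) <= E_n(f) + e <= E_m(f) + e]. *)
  have -> : g = f - (f - g) by rewrite subKr.
  rewrite -[f - (f - g)]/(f + (- (f - g))).
  apply: le_trans (best_approxD k1 qN sX _ _ _) _; rewrite ler_wpM2l //.
  have := best_approx_le_qnorm qN sX m (- (f - g)).
  rewrite (qnormN qN); have := best_approx_decr qN sX f mn.
  by move: gE; lra.
- by move=> m; rewrite addr_ge0 ?mulr_ge0 // /u; case: ifP => // _; exact: ltW.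
apply: hCa; [by rewrite addr_ge0 // ltW|by move=> m; rewrite mulr_ge0| | |].
- by move=> m; rewrite /u; case: ifP => // _; exact: ltW.
- apply: (@seqnorm_le_weaken _ _ _ _ 2) => //; first by rewrite lerDl ltW.
  rewrite -[X in seqnorm_le _ _ _ X]mulr1.
  apply: (seqnorm_le_scale q0 (e' := fun m => best_approx N XX m f)) => //.
    by move=> m; rewrite mulr_ge0 //=.
  exact: iffLR (approx_norm_leP _ _ _ _ q0 ler01) Kf.
- apply: (@seqnorm_le_weaken _ _ _ _ (Ct * (e * n.+1%:R `^ s))) => //.
  + by rewrite !mulr_ge0 ?powR_ge0 // ltW.
  + rewrite /e -powRD ?pnatr_eq0 ?implybT // addNr powRr0 mulr1.
    by rewrite lerDr.
  + apply: hCt => [|m|m nm]; first exact: ltW.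
      by rewrite /u; case: ifP => _; rewrite ?lexx ?(ltW e0).
    by rewrite /u leqNgt nm.
Qed.

Lemma best_approx_ball_decay (R : realType) (s : R) (q : \bar R) :
  0 < s -> (0 < q)%E -> exists2 C : R, 0 < C &
  forall (kappa : R) (X : lmodType R) (N : X -> R) (XX : nat -> set X),
  quasi_banach kappa N -> approximation_scheme N XX ->
  forall t f, 0 <= t -> (approx_norm N XX s q f <= t%:E)%E ->
  forall n, n.+1%:R `^ s * best_approx N XX n f <= C * t.
Proof.
move=> s0 q0; have [C C0 hC] := seqnorm_le_decr s0 q0; exists C => //.
move=> kappa X N XX qN sX t f t0 /(approx_norm_leP _ _ _ _ q0 t0) h.
apply: hC h => // [k|k n kn]; first exact: best_approx_ge0 qN sX _ _.
exact: best_approx_decr qN sX _ _ _ kn.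
Qed.

(* Bernstein's inequality.  For [s' > 0] the last hypothesis is a bound on the
   [A^s'_oo] norm of [x]; for [s' = 0] it follows from [N x <= D]. *)
Lemma bernstein (R : realType) (s s' D : R) (q : \bar R) :
  s' < s -> (0 < q)%E -> 0 < D -> exists2 c : R, 0 < c &
  forall (kappa : R) (X : lmodType R) (N : X -> R) (XX : nat -> set X),
  quasi_banach kappa N -> approximation_scheme N XX ->
  forall n x, XX (n.+1).*2 x ->
  (forall m, m.+1%:R `^ s' * best_approx N XX m x <= D) ->
  approx_ball N XX s q ((c * n.+1%:R `^ (- (s - s'))) *: x).
Proof.
move=> ss' q0 D0; have r0 : 0 < s - s' by rewrite subr_gt0.
have [C C0 hC] := seqnorm_le_trunc r0 q0.
have c0 : 0 < C * D * 3 `^ (s - s') by rewrite !mulr_gt0 // powR_gt0.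
(* The 3 comes from [2 * (n + 1) + 1 <= 3 * (n + 1)], as [x] lies in [X_(2n+2)]. *)
exists (C * D * 3 `^ (s - s'))^-1; first by rewrite invr_gt0.
move=> kappa X N XX qN sX n x Xx hx.
have E0 m h := best_approx_ge0 qN sX m h.
set b := C * D * 3 `^ (s - s') in c0 *.
have n0 : 0 < n.+1%:R `^ (s - s') :> R by exact: powR_gt0.
have -> : b^-1 * n.+1%:R `^ (- (s - s')) = (b * n.+1%:R `^ (s - s'))^-1.
  by rewrite powRN [RHS]invfM.
set a := b * _; have a0 : 0 < a by rewrite mulr_gt0.
rewrite /approx_ball /=.
have -> : 1%E = (`|a^-1| * a)%:E :> \bar R.
  by rewrite ger0_norm ?invr_ge0 ?(ltW a0) // mulVf ?gt_eqF.
apply: (approx_norm_dilate qN sX) => //; first exact: ltW.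
apply/approx_norm_leP => //; first exact: ltW.
apply: (@seqnorm_le_shift _ s s').
apply: (@seqnorm_le_weaken _ _ _ _
  (C * (D * (n.+1).*2.+1%:R `^ (s - s')))) => //.
- by rewrite !mulr_ge0 ?powR_ge0 // ltW.
- rewrite /a /b -!mulrA ler_pM2l // ler_pM2l // -powRM //.
  apply: ler_powRl => //; first exact: ltW.
  by rewrite -natrM ler_nat mulSn mul2n -add1n leq_add2r.
- apply: hC => [|m|m nm]; first exact: ltW.
    by rewrite hx mulr_ge0 ?powR_ge0.
  by rewrite (best_approx_eq0 qN sX (scheme_le sX (ltnW nm) Xx)) mulr0.
Qed.

Theorem theorem6p5 (R : realType) :
  (forall (s : R) (q : \bar R), 0 < s -> (0 < q)%E ->
   exists2 C : R, 0 < C & forall kappa : R,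
   exists2 c : R, 0 < c &
   forall (X : lmodType R) (N : X -> R), quasi_banach kappa N ->
   exists2 gamma0 : R, 1 <= gamma0 &
   forall XX : nat -> set X, approximation_scheme N XX ->
   forall gamma : R, gamma0 <= gamma ->
   forall n : nat,
     let d := constrained_width (fun x => (N x)%:E) gamma
                (approx_ball N XX s q) n in
     ((c * n.+1%:R `^ (- s))%:E <= d)%E /\
     (d <= (C * n.+1%:R `^ (- s))%:E)%E)
  /\
  (forall (s s' : R) (q q' : \bar R),
   0 < s' -> s' < s -> (0 < q)%E -> (0 < q')%E ->
   exists2 C : R, 0 < C & forall kappa : R,
   exists2 c : R, 0 < c &
   forall (X : lmodType R) (N : X -> R), quasi_banach kappa N ->
   exists2 gamma0 : R, 1 <= gamma0 &
   forall XX : nat -> set X, approximation_scheme N XX ->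
   forall gamma : R, gamma0 <= gamma ->
   forall n : nat,
     let d := constrained_width (approx_norm N XX s' q') gamma
                (approx_ball N XX s q) n in
     ((c * n.+1%:R `^ (- (s - s')))%:E <= d)%E /\
     (d <= (C * n.+1%:R `^ (- (s - s')))%:E)%E).
Proof.
have delta0 (k : R) : 1 <= k -> 0 < (2 * k) ^- 9.
  by move=> k1; rewrite invr_gt0 exprn_gt0 // mulr_gt0 // (lt_le_trans _ k1).
have wpow (s x y : R) (n : nat) :
    n.+1%:R `^ s * x <= y -> x <= y * n.+1%:R `^ (- s).
  by move=> le; rewrite powRN ler_pdivlMr ?powR_gt0 // mulrC.
split.
- move=> s q s0 q0; have [Cd Cd0 hCd] := best_approx_ball_decay s0 q0.
  exists (Cd + 1); first by rewrite addr_gt0.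
  (* [C] is already fixed, hence independent of the space. The maximum with 1 keeps the
     quasi-triangle inequality valid and ensures [1 <= kappa]. *)
  move=> kappa0; pose kappa := Num.max 1 kappa0.
  have k1 : 1 <= kappa by rewrite le_max lexx.
  have [a a0 ha] := bernstein s0 q0 ltr01.
  exists (((2 * kappa) ^- 9) * a); first by rewrite mulr_gt0 // delta0.
  move=> X N qN0; have qN : quasi_banach kappa N.
    by apply: quasi_banach_weaken qN0; rewrite le_max lexx orbT.
  have [g0 g1 hg] := constrained_near_best s0 q0 k1.
  exists g0 => // XX sX gamma gg n d; split.
    rewrite /d -mulrA.
    apply: (width_ge _ k1 (gauge_qnorm k1 qN) (scheme_dim sX _)).
    + by move=> x _; exists (N x).
    + by rewrite mulr_gt0 // powR_gt0.
    (* Bernstein's inequality was taken with [s' = 0], so the exponent must read [s - 0]. *)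
    + move=> x Wx Nx; rewrite -[s in - s]subr0.
      apply: (ha _ _ _ _ qN sX) => // m.
      rewrite powRr0 mul1r; apply: le_trans (best_approx_le_qnorm qN sX m x) _.
      by rewrite -lee_fin.
  apply: (width_le (scheme_dim sX n)) => [v _|f Kf]; first exact: ltry.
  have [g [Xg Kg gE]] := hg _ _ _ qN sX _ gg n f Kf.
  exists g; split => //; rewrite lee_fin mulrDl mul1r.
  apply: le_trans gE _; rewrite lerD2r.
  by apply: wpow; have := hCd _ _ _ _ qN sX _ _ ler01 Kf n; rewrite mulr1.
- move=> s s' q q' s'0 ss' q0 q'0.
  have s0 : 0 < s by exact: lt_trans ss'.
  have [Cd Cd0 hCd] := best_approx_ball_decay s0 q0.
  have [Cd' Cd'0 hCd'] := best_approx_ball_decay s'0 q'0.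
  have [Cp Cp0 hCp] := seqnorm_le_profile s'0 ss' q'0.
  have Cd1 : 0 < Cd + 1 by rewrite addr_gt0.
  exists (Cp * (Cd + 1)); first by rewrite mulr_gt0.
  move=> kappa0; pose kappa := Num.max 1 kappa0.
  have k1 : 1 <= kappa by rewrite le_max lexx.
  have [kappa' k1' gM] := gauge_approx_norm s' k1 q'0.
  (* [Cd'] bounds the [A^s'_oo] norm on the unit ball of [A^s'_q'], as Bernstein's inequality
     requires. *)
  have [a a0 ha] := bernstein ss' q0 Cd'0.
  exists (((2 * kappa') ^- 9) * a); first by rewrite mulr_gt0 // delta0.
  move=> X N qN0; have qN : quasi_banach kappa N.
    by apply: quasi_banach_weaken qN0; rewrite le_max lexx orbT.
  have [g0 g1 hg] := constrained_near_best s0 q0 k1.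
  exists g0 => // XX sX gamma gg n d; split.
    rewrite /d -mulrA.
    apply: (width_ge _ k1' (gM _ _ _ qN sX) (scheme_dim sX _)).
    + by move=> x; exact: (approx_norm_fin qN sX s'0 q'0).
    + by rewrite mulr_gt0 // powR_gt0.
    + move=> x Wx Nx; apply: (ha _ _ _ _ qN sX) => // m.
      by have := hCd' _ _ _ _ qN sX _ _ ler01 Nx m; rewrite mulr1.
  apply: (width_le (scheme_dim sX n)) => [v Xv|f Kf].
    have [x] := approx_norm_fin qN sX s'0 q'0 Xv.
    by move=> /le_lt_trans; apply; exact: ltry.
  have [g [Xg Kg gE]] := hg _ _ _ qN sX _ gg n f Kf.
  exists g; split => //.
  have E0 m h := best_approx_ge0 qN sX m h.
  have Ef m : best_approx N XX m f <= Cd * m.+1%:R `^ (- s).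
    by apply: wpow; have := hCd _ _ _ _ qN sX _ _ ler01 Kf m; rewrite mulr1.
  apply/approx_norm_leP => //.
    by rewrite mulr_ge0 ?powR_ge0 // mulr_ge0 ?(ltW Cp0) // ltW.
  (* For [m <= n] the error of [f - g] is at most its norm; for [m > n], [g] is in [X_m] and
     subtracting it does not increase the error of [f]. *)
  rewrite -mulrA; apply: hCp => [|m]; first exact: ltW.
  rewrite E0 /=; have [mn|nm] := leqP m n.
    apply: le_trans (best_approx_le_qnorm qN sX _ _) _.
    by apply: le_trans gE _; rewrite mulrDl mul1r lerD2r.
  apply: le_trans (best_approx_sub_le qN sX f (scheme_le sX (ltnW nm) Xg)) _.
  by apply: le_trans (Ef m) _; rewrite ler_wpM2r ?powR_ge0 // lerDl.
Qed.
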